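(* Let $\Gamma$ be a forwarder context. Then $\Gamma$ has a live path if and only if there exists a forwarder process $F$ such that $F\Vdash\Gamma$ is derivable.
   Context: We write $\wp$ for the ''par'' connective of linear logic. **Types.** $A::=a\mid a^\perp\mid 1\mid\bot\mid A\otimes A\mid A\wp A$, with the usual involutive duality: $(a^\perp)^\perp=a$, $1^\perp=\bot$, $(A\otimes B)^\perp=A^\perp\wp B^\perp$. **Annotated types:** $B::=a\mid a^\perp\mid 1^{u_1,\dots,u_n}\mid\bot^u\mid A\otimes^uB\mid A\wp^uB$, where $u,u_i$ are names (endpoints), $n\ge1$, the $u_i$ are distinct, and the left component $A$ of $\otimes^u,\wp^u$ is an unannotated type. For unannotated $A$ and a name $x$, $A(x)$ is the annotated type obtained by annotating every annotatable operator of $A$ with $x$. Duality on annotated types keeps the annotations. **Processes.** $P,Q::=x\leftrightarrow y\mid x().P\mid x[]\mid x(y).P\mid x[y\triangleright P].Q$ (link, wait, close, input binding $y$ in $P$, output binding $y$ in the spawned process $P$ and continuing as $Q$), up to renaming of bound names. **Queues and contexts.** A queue is $[\![\Psi]\!]::=\varnothing\mid[^u*][\![\Psi]\!]\mid[^u\,y{:}A][\![\Psi]\!]$ with $A$ unannotated; queues are identified up to swapping adjacent boxes with different labels $u\neq v$. A forwarder context is $\Gamma::=\varnothing\mid\Gamma,[\![\Psi]\!]x{:}B\mid\Gamma,[\![\Psi]\!]x{:}\cdot$ with $B$ annotated and distinct names; $x{:}\cdot$ (with a non-empty queue) is a terminated endpoint. The order of context entries is irrelevant and the empty queue is omitted in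 writing. **Forwarder rules** ($C$ below is an annotated type or $\cdot$): - Ax: $x\leftrightarrow y\Vdash x{:}a^\perp,y{:}a$. - $1$: $x[]\Vdash\{[^x*]u_i{:}\cdot\}_{1\le i\le n},\,x{:}1^{u_1,\dots,u_n}$. - $\bot$: from $P\Vdash\Gamma,[\![\Psi]\!][^u*]x{:}\cdot$ infer $x().P\Vdash\Gamma,[\![\Psi]\!]x{:}\bot^u$. - $\wp$: from $P\Vdash\Gamma,[\![\Psi]\!][^u\,y{:}A]x{:}B$ infer $x(y).P\Vdash\Gamma,[\![\Psi]\!]x{:}A\wp^uB$. - $\otimes$: from $P\Vdash z{:}(A(y))^\perp,\,y{:}A(z)$ and $Q\Vdash\Gamma,[\![\Psi_u]\!]u{:}C,[\![\Psi_x]\!]x{:}B$ infer $x[y\triangleright P].Q\Vdash\Gamma,[^x\,z{:}A^\perp][\![\Psi_u]\!]u{:}C,[\![\Psi_x]\!]x{:}A\otimes^uB$. **Type-context semantics.** $\xrightarrow{\alpha}$ is the least relation such that ($y$ fresh; $\checkmark$ denotes successful termination; $C$ an annotated type or $\cdot$): - $\Gamma,[\![\Psi]\!]x{:}A\wp^uB\xrightarrow{x\otimes u}\Gamma,[\![\Psi]\!][^u\,y{:}A]x{:}B$; - $\Gamma,[^x\,z{:}A^\perp][\![\Psi_u]\!]u{:}C,[\![\Psi_x]\!]x{:}A\otimes^uB\xrightarrow{x\wp u}\Gamma,[\![\Psi_u]\!]u{:}C,[\![\Psi_x]\!]x{:}B$; - $\Gamma,[\![\Psi]\!]x{:}\bot^u\xrightarrow{x1u}\Gamma,[\![\Psi]\!][^u*]x{:}\cdot$;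 - $\{[^x*]u_i{:}\cdot\}_{1\le i\le n},x{:}1^{\tilde u}\xrightarrow{x\bot\tilde u}\checkmark$, where $\tilde u=u_1,\dots,u_n$; - $x{:}a^\perp,y{:}a\xrightarrow{x\leftrightarrow y}\checkmark$. **Paths.** $\alpha_1,\dots,\alpha_n$ is a path for $\Gamma=\Gamma_0$ if there are $\Gamma_1,\dots,\Gamma_n$ with $\Gamma_0\xrightarrow{\alpha_1}\Gamma_1\cdots\xrightarrow{\alpha_n}\Gamma_n$. The path is **live** if $\Gamma_n=\checkmark$ and, for every $i<n$: 1. if $\Gamma_i=\Gamma_i',[^x\,z{:}A^\perp][\![\Psi_u]\!]u{:}C$, then there is $k>i$ with $\alpha_k=x\wp u$; 2. if $\Gamma_i=\Gamma_i',[^x*]u{:}\cdot$, then $\alpha_n=x\bot\tilde u$ with $u\in\tilde u$; 3. if $\Gamma_i=\Gamma_i',[\![\Psi_x]\!]x{:}A\otimes^uB$, then there is $k>i$ with $\alpha_k=x\wp u$; 4. if $\Gamma_i=\Gamma_i',[\![\Psi_x]\!]x{:}1^{\tilde u}$, then $\alpha_n=x\bot\tilde u$. *)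

(* Defs.v *)
From Stdlib Require Import List Permutation PeanoNat.
Import ListNotations.

Definition name := nat.
Definition atom := nat.

(** * Types *)

Inductive typ :=
| Var (a : atom)
| CoVar (a : atom)
| One
| Bot
| Tensor (A B : typ)
| Par (A B : typ).

Fixpoint dual (A : typ) : typ :=
  match A with
  | Var a => CoVar a
  | CoVar a => Var a
  | One => Bot
  | Bot => One
  | Tensor A B => Par (dual A) (dual B)
  | Par A B => Tensor (dual A) (dual B)
  end.

Inductive atyp :=
| AVar (a : atom)
| ACoVar (a : atom)
| AOne (us : list name)
| ABot (u : name)
| ATensor (u : name) (A : typ) (B : atyp)
| APar (u : name) (A : typ) (B : atyp).

Fixpoint atyp_ok (B : atyp) : Prop :=
  match B with
  | AVar _ | ACoVar _ | ABot _ => True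
  | AOne us => us <> [] /\ NoDup us
  | ATensor _ _ B | APar _ _ B => atyp_ok B
  end.

(** [annot A x] is A(x). *)
Fixpoint annot (A : typ) (x : name) : atyp :=
  match A with
  | Var a => AVar a
  | CoVar a => ACoVar a
  | One => AOne [x]
  | Bot => ABot x
  | Tensor A B => ATensor x A (annot B x)
  | Par A B => APar x A (annot B x)
  end.

(** Bot carries exactly one name, so the dual of [AOne us] is meaningful only
    when [us] is a singleton, which is always so in [adual (annot A x)]; on
    other lists the value is a junk convention. *)
Fixpoint adual (B : atyp) : atyp :=
  match B with
  | AVar a => ACoVar a
  | ACoVar a => AVar a
  | AOne us => ABot (hd 0 us)
  | ABot u => AOne [u]
  | ATensor u A B => APar u (dual A) (adual B)
  | APar u A B => ATensor u (dual A) (adual B)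
  end.

Fixpoint atyp_names (B : atyp) : list name :=
  match B with
  | AVar _ | ACoVar _ => []
  | AOne us => us
  | ABot u => [u]
  | ATensor u _ B | APar u _ B => u :: atyp_names B
  end.

(** * Processes *)

(** [Inp x y P] is x(y).P and binds [y] in [P]; [Out x y P Q] is x[y |> P].Q and
    binds [y] in [P] only. *)
Inductive proc :=
| Link (x y : name)
| Wait (x : name) (P : proc)
| Close (x : name)
| Inp (x y : name) (P : proc)
| Out (x y : name) (P Q : proc).

Definition swap (a b x : name) : name :=
  if x =? a then b else if x =? b then a else x.

Fixpoint pswap (a b : name) (P : proc) : proc :=
  match P with
  | Link x y => Link (swap a b x) (swap a b y)
  | Wait x P => Wait (swap a b x) (pswap a b P)
  | Close x => Close (swap a b x)
  | Inp x y P => Inp (swap a b x) (swap a b y) (pswap a b P)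
  | Out x y P Q =>
      Out (swap a b x) (swap a b y) (pswap a b P) (pswap a b Q)
  end.

(** All names of a process, binding occurrences included. *)
Fixpoint proc_names (P : proc) : list name :=
  match P with
  | Link x y => [x; y]
  | Wait x P => x :: proc_names P
  | Close x => [x]
  | Inp x y P => x :: y :: proc_names P
  | Out x y P Q => x :: y :: proc_names P ++ proc_names Q
  end.

(** Equality up to renaming of bound names. *)
Inductive alpha : proc -> proc -> Prop :=
| alpha_link x y : alpha (Link x y) (Link x y)
| alpha_wait x P P' : alpha P P' -> alpha (Wait x P) (Wait x P')
| alpha_close x : alpha (Close x) (Close x)
| alpha_inp x y y' w P P' :
    ~ In w (y :: y' :: proc_names P ++ proc_names P') ->
    alpha (pswap y w P) (pswap y' w P') ->
    alpha (Inp x y P) (Inp x y' P')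
| alpha_out x y y' w P P' Q Q' :
    ~ In w (y :: y' :: proc_names P ++ proc_names P') ->
    alpha (pswap y w P) (pswap y' w P') ->
    alpha Q Q' ->
    alpha (Out x y P Q) (Out x y' P' Q').

(** * Queues and forwarder contexts *)

Inductive box :=
| Star (u : name)
| Msg (u y : name) (A : typ).

Definition label (b : box) : name :=
  match b with Star u | Msg u _ _ => u end.

(** The head of the list is the front of the queue. *)
Definition queue := list box.

Inductive queue_eq : queue -> queue -> Prop :=
| queue_eq_refl q : queue_eq q q
| queue_eq_swap q1 b b' q2 :
    label b <> label b' ->
    queue_eq (q1 ++ b :: b' :: q2) (q1 ++ b' :: b :: q2)
| queue_eq_trans q1 q2 q3 :
    queue_eq q1 q2 -> queue_eq q2 q3 -> queue_eq q1 q3.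

(** [Entry x q (Some B)] is the entry x : B with queue q, and [Entry x q None]
    is the terminated endpoint x : . with queue q. *)
Record entry := Entry {
  endpoint : name;
  entry_queue : queue;
  entry_type : option atyp
}.

Definition ctx := list entry.

Definition entry_eq (e e' : entry) : Prop :=
  endpoint e = endpoint e' /\
  entry_type e = entry_type e' /\
  queue_eq (entry_queue e) (entry_queue e').

Definition ctx_eq (G D : ctx) : Prop :=
  exists G', Permutation G G' /\ Forall2 entry_eq G' D.

Definition msg_names (q : queue) : list name :=
  flat_map (fun b => match b with Star _ => [] | Msg _ y _ => [y] end) q.

(** The names that a context assigns a type to: its endpoints, and the names
    carried by the boxes of its queues (also free in the typed process). *)
Definition declared (G : ctx) : list name :=
  flat_map (fun e => endpoint e :: msg_names (entry_queue e)) G.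

Definition entry_ok (e : entry) : Prop :=
  match entry_type e with
  | Some B => atyp_ok B
  | None => entry_queue e <> []
  end.

Definition forwarder_ctx (G : ctx) : Prop :=
  NoDup (declared G) /\ Forall entry_ok G.

Definition box_names (b : box) : list name :=
  match b with Star u => [u] | Msg u y _ => [u; y] end.

Definition entry_names (e : entry) : list name :=
  endpoint e :: flat_map box_names (entry_queue e) ++
  match entry_type e with Some B => atyp_names B | None => [] end.

(** [y] does not occur in [G] at all, annotations and labels included. *)
Definition fresh (y : name) (G : ctx) : Prop := ~ In y (flat_map entry_names G).

(** {[^x *] u_i : .}_i, x : 1^us *)
Definition one_ctx (x : name) (us : list name) : ctx :=
  map (fun u => Entry u [Star x] None) us ++ [Entry x [] (Some (AOne us))].

(** * Forwarder rules *)

(** Judgements are about forwarder contexts (each logical rule checks its conclusion);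
    contexts and processes are taken up to [ctx_eq] and [alpha]. *)
Inductive typed : proc -> ctx -> Prop :=
| t_ax x y a :
    let D := [Entry x [] (Some (ACoVar a)); Entry y [] (Some (AVar a))] in
    forwarder_ctx D -> typed (Link x y) D
| t_one x us :
    forwarder_ctx (one_ctx x us) -> typed (Close x) (one_ctx x us)
| t_bot G q x u P :
    let D := Entry x q (Some (ABot u)) :: G in
    forwarder_ctx D ->
    typed P (Entry x (q ++ [Star u]) None :: G) ->
    typed (Wait x P) D
| t_par G q x y u A B P :
    let D := Entry x q (Some (APar u A B)) :: G in
    forwarder_ctx D -> fresh y D ->
    typed P (Entry x (q ++ [Msg u y A]) (Some B) :: G) ->
    typed (Inp x y P) D
| t_tensor G qu qx x y z u A B (C : option atyp) P Q :
    let D := Entry u (Msg x z (dual A) :: qu) C ::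
             Entry x qx (Some (ATensor u A B)) :: G in
    forwarder_ctx D ->
    typed P [Entry z [] (Some (adual (annot A y)));
             Entry y [] (Some (annot A z))] ->
    typed Q (Entry u qu C :: Entry x qx (Some B) :: G) ->
    typed (Out x y P Q) D
| t_ctx_eq P G D : ctx_eq G D -> typed P G -> typed P D
| t_alpha P Q G : alpha P Q -> typed P G -> typed Q G.

(** * Type-context semantics *)

Inductive action :=
| ActTensor (x u : name)
| ActPar (x u : name)
| ActOne (x u : name)
| ActBot (x : name) (us : list name)
| ActLink (x y : name).

Inductive state :=
| Running (G : ctx)
| Done.

Inductive step : state -> action -> state -> Prop :=
| s_par G q x y u A B :
    let D := Entry x q (Some (APar u A B)) :: G in
    fresh y D ->
    step (Running D) (ActTensor x u)
         (Running (Entry x (q ++ [Msg u y A]) (Some B) :: G))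
| s_tensor G qu qx x z u A B (C : option atyp) :
    step (Running (Entry u (Msg x z (dual A) :: qu) C ::
                   Entry x qx (Some (ATensor u A B)) :: G))
         (ActPar x u)
         (Running (Entry u qu C :: Entry x qx (Some B) :: G))
| s_bot G q x u :
    step (Running (Entry x q (Some (ABot u)) :: G)) (ActOne x u)
         (Running (Entry x (q ++ [Star u]) None :: G))
| s_one x us :
    step (Running (one_ctx x us)) (ActBot x us) Done
| s_ax x y a :
    step (Running [Entry x [] (Some (ACoVar a)); Entry y [] (Some (AVar a))])
         (ActLink x y) Done
| s_eq_l G G' act S :
    ctx_eq G G' -> step (Running G') act S -> step (Running G) act S
| s_eq_r S act G G' :
    step S act (Running G') -> ctx_eq G' G -> step S act (Running G).

(** * Paths *)

Definition state_ok (s : state) : Prop :=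
  match s with Running G => forwarder_ctx G | Done => True end.

(** The actions are [act 1], ..., [act n] and the states [st 0], ..., [st n];
    values of [act] and [st] at other indices are irrelevant. *)
Definition path (G : ctx) (n : nat) (act : nat -> action) (st : nat -> state)
    : Prop :=
  st 0 = Running G /\
  (forall i, i <= n -> state_ok (st i)) /\
  (forall i, i < n -> step (st i) (act (S i)) (st (S i))).

Definition has_form (s : state) (D : ctx) : Prop :=
  exists G, s = Running G /\ ctx_eq G D.

Definition live (n : nat) (act : nat -> action) (st : nat -> state) : Prop :=
  st n = Done /\
  forall i, i < n ->
    (forall G x z A q u (C : option atyp),
       has_form (st i) (Entry u (Msg x z (dual A) :: q) C :: G) ->
       exists k, i < k <= n /\ act k = ActPar x u) /\
    (forall G x u,
       has_form (st i) (Entry u [Star x] None :: G) ->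
       exists us, act n = ActBot x us /\ In u us) /\
    (forall G q x u A B,
       has_form (st i) (Entry x q (Some (ATensor u A B)) :: G) ->
       exists k, i < k <= n /\ act k = ActPar x u) /\
    (forall G q x us,
       has_form (st i) (Entry x q (Some (AOne us)) :: G) ->
       act n = ActBot x us).

Definition has_live_path (G : ctx) : Prop :=
  exists n act st, path G n act st /\ live n act st.

(* Main.v *)
(** The typing rules and the transitions correspond one to one, except that the
    output rule has an extra premise, which identity expansion always provides.
    Hence a context is derivable iff some path leads from it to termination.
    Liveness is then automatic: a pending box, tensor, star or unit stays in the
    context until the action that consumes it, and none of them is in [Done]. *)
From Stdlib Require Import List Permutation Lia.
Require Import Defs.
Import ListNotations.

(** * Equality of contexts *)

Lemma queue_eq_sym q q' : queue_eq q q' -> queue_eq q' q.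
Proof. induction 1; eauto using queue_eq. Qed.

Lemma queue_eq_perm q q' : queue_eq q q' -> Permutation q q'.
Proof.
  induction 1; eauto using Permutation.
  apply Permutation_app_head, perm_swap.
Qed.

Lemma entry_eq_sym e e' : entry_eq e e' -> entry_eq e' e.
Proof. intros (H1 & H2 & H3). repeat split; auto using queue_eq_sym. Qed.

Lemma Forall2_entry_eq_refl (G : ctx) : Forall2 entry_eq G G.
Proof.
  induction G; constructor; auto.
  repeat split; auto using queue_eq_refl.
Qed.

Lemma ctx_eq_perm G D : Permutation G D -> ctx_eq G D.
Proof. intros H; exists D; auto using Forall2_entry_eq_refl. Qed.

Lemma ctx_eq_sym G D : ctx_eq G D -> ctx_eq D G.
Proof.
  intros (G' & HP & HF).
  destruct (Permutation_Forall2 (Permutation_sym HP) HF) as (D' & HP' & HF').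
  exists D'; split; auto.
  clear - HF'. induction HF'; constructor; auto using entry_eq_sym.
Qed.

Lemma msg_names_perm q q' :
  Permutation q q' -> Permutation (msg_names q) (msg_names q').
Proof. apply Permutation_flat_map. Qed.

(** Reordering entries and swapping boxes only permutes the declared names, and a non-empty queue
    stays non-empty under permutation. *)
Lemma forwarder_ctx_eq G D : ctx_eq G D -> forwarder_ctx G -> forwarder_ctx D.
Proof.
  intros (G' & HP & HF) [Hnd Hok].
  apply (Permutation_NoDup (Permutation_flat_map _ HP)) in Hnd.
  rewrite HP in Hok. clear HP G.
  enough (Permutation (declared G') (declared D) /\ Forall entry_ok D) as [H1 H2]
    by (split; [eapply Permutation_NoDup; eauto | auto]).
  clear Hnd. induction HF as [|[x q T] [y q' T'] G' D (E1 & E2 & E3) HF IH].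
  - split; auto.
  - inversion Hok as [|? ? He Hok']; subst.
    destruct (IH Hok') as [IH1 IH2]. simpl in *; subst.
    apply queue_eq_perm in E3. split.
    + constructor. apply Permutation_app; auto using msg_names_perm.
    + constructor; auto.
      unfold entry_ok in *; simpl in *. destruct T'; auto.
      intros ->. apply He, Permutation_nil. now symmetry.
Qed.

Lemma typed_forwarder P G : typed P G -> forwarder_ctx G.
Proof. induction 1; eauto using forwarder_ctx_eq. Qed.

(** * Identity expansion *)

Lemma dual_dual A : dual (dual A) = A.
Proof. induction A; simpl; congruence. Qed.

(** At [One], [annot] produces the singleton [[x]], so the head taken by [adual] is [x] and never
    the default. *)
Lemma adual_annot A x : adual (annot A x) = annot (dual A) x.
Proof. induction A; simpl; congruence. Qed.

Lemma annot_ok A x : atyp_ok (annot A x).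
Proof.
  induction A; simpl; auto.
  split; [easy | repeat constructor; easy].
Qed.

Lemma exists_not_in (l : list name) : exists y, ~ In y l.
Proof.
  exists (S (list_max l)). intros H.
  pose proof (proj1 (list_max_le l _) (le_n _)) as Hl.
  rewrite Forall_forall in Hl. specialize (Hl _ H). lia.
Qed.

Lemma forwarder_pair x y q A B :
  NoDup (x :: msg_names q ++ [y]) -> atyp_ok A -> atyp_ok B ->
  forwarder_ctx [Entry x q (Some A); Entry y [] (Some B)].
Proof.
  intros H HA HB. split; simpl; [now rewrite ?app_nil_r | repeat constructor; auto].
Qed.

Lemma typed_swap P e e' : typed P [e; e'] -> typed P [e'; e].
Proof. apply t_ctx_eq, ctx_eq_perm, perm_swap. Qed.

Lemma identity_link a x y :
  x <> y ->
  exists P, typed P [Entry x [] (Some (ACoVar a)); Entry y [] (Some (AVar a))].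
Proof.
  intros H. exists (Link x y). apply t_ax, forwarder_pair; simpl; auto.
  repeat constructor; simpl; intuition congruence.
Qed.

Lemma identity_unit x y :
  x <> y ->
  exists P, typed P [Entry x [] (Some (ABot y)); Entry y [] (Some (AOne [x]))].
Proof.
  intros H. exists (Wait x (Close y)).
  (* Once the wait has queued its star, the context is literally [one_ctx y [x]]. *)
  apply t_bot; [|apply (t_one y [x])].
  - apply forwarder_pair; simpl; try easy;
      repeat constructor; simpl; intuition congruence.
  - split; [|repeat constructor; simpl; easy].
    simpl. repeat constructor; simpl; intuition congruence.
Qed.

(** The forwarder receives [w] on [x], sends a new [v] on [y], links the two by the identity on
    [A'], and continues with [Q]. The identities on the components are hypotheses, and [A = dual A']
    is an equation, so that one lemma serves both the tensor and the par case. *)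
Lemma identity_multiplicative x y A A' B B' :
  x <> y -> atyp_ok B -> atyp_ok B' -> A = dual A' ->
  (forall w v, w <> v ->
     exists P, typed P [Entry w [] (Some (adual (annot A' v)));
                        Entry v [] (Some (annot A' w))]) ->
  (exists Q, typed Q [Entry x [] (Some B); Entry y [] (Some B')]) ->
  exists P, typed P [Entry x [] (Some (APar y A B));
                     Entry y [] (Some (ATensor x A' B'))].
Proof.
  intros Hxy HB HB' -> HP [Q HQ].
  set (D := [Entry x [] (Some (APar y (dual A') B));
             Entry y [] (Some (ATensor x A' B'))]).
  destruct (exists_not_in (flat_map entry_names D)) as [w Hw].
  destruct (exists_not_in [w]) as [v Hv].
  destruct (HP w v) as [P' HP']; [simpl in Hv; intuition congruence|].
  exists (Inp x w (Out y v P' Q)). apply t_par; auto.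
  - apply forwarder_pair; auto.
    repeat constructor; simpl; intuition congruence.
  - apply t_tensor; auto.
    apply forwarder_pair; auto.
    simpl in Hw. repeat constructor; simpl; intuition congruence.
Qed.

Lemma identity_expansion A x y :
  x <> y ->
  exists P, typed P [Entry x [] (Some (adual (annot A y)));
                     Entry y [] (Some (annot A x))].
Proof.
  revert x y. induction A as [a|a| | |A IHA B IHB|A IHA B IHB]; intros x y H;
    rewrite adual_annot; simpl.
  - now apply identity_link.
  - destruct (identity_link a y x) as [P HP]; eauto using typed_swap.
  - now apply identity_unit.
  - destruct (identity_unit y x) as [P HP]; eauto using typed_swap.
  - apply identity_multiplicative; auto using annot_ok.
    rewrite <- adual_annot; auto.
  (* Exchanging the endpoints turns par into the previous case, with [dual A] as the sent type and
     [A] equal to its double dual. *)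
  - destruct (identity_multiplicative y x A (dual A) (annot B x) (annot (dual B) y))
      as [P HP]; eauto using typed_swap, annot_ok.
    + now rewrite dual_dual.
    + intros w v Hwv. destruct (IHA v w) as [P HP]; auto.
      rewrite adual_annot, dual_dual. rewrite adual_annot in HP.
      eauto using typed_swap.
    + rewrite <- adual_annot. destruct (IHB x y) as [P HP]; eauto using typed_swap.
Qed.

(** * Derivability is termination *)

(** An index-free form of a path of well-formed contexts ending in [Done], suited to induction on
    derivations. *)
Inductive terminating : state -> Prop :=
| terminating_done : terminating Done
| terminating_step G a s :
    forwarder_ctx G -> step (Running G) a s -> terminating s ->
    terminating (Running G).

Definition derivable (s : state) : Prop :=
  match s with Running G => exists P, typed P G | Done => True end.

(** Each logical rule, read from conclusion to premise, is a step. For output the path follows the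
    continuation, and the spawned process leaves no trace. *)
Lemma typed_terminating P G : typed P G -> terminating (Running G).
Proof.
  induction 1 as [x y a D HD|x us HD|G q x u P D HD HP IH
    |G q x y u A B P D HD Hy HP IH|G qu qx x y z u A B C P Q D HD HP _ HQ IH
    |P G D E HP IH|]; auto.
  - eapply terminating_step; [exact HD | apply s_ax | constructor].
  - eapply terminating_step; [exact HD | apply s_one | constructor].
  - eapply terminating_step; [exact HD | apply s_bot | exact IH].
  - eapply terminating_step; [exact HD | apply s_par, Hy | exact IH].
  - eapply terminating_step; [exact HD | apply s_tensor | exact IH].
  (* Equality of contexts adds no step: it is absorbed into the first step of the path obtained by
     induction. *)
  - inversion IH as [|? a s HG Hs Ht]; subst.
    eapply terminating_step; [|eapply s_eq_l|]; eauto using forwarder_ctx_eq, ctx_eq_sym.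
Qed.

(** Each step read backwards is a rule. Only output demands more than the derivation for the target:
    its spawned process comes from [identity_expansion], with any [y] distinct from [z]. *)
Lemma step_derivable s a s' :
  step s a s' -> state_ok s -> derivable s' -> derivable s.
Proof.
  induction 1; simpl; intros Hok Hd.
  - destruct Hd as [P HP]. eauto using typed.
  - destruct Hd as [Q HQ]. destruct (exists_not_in [z]) as [y Hy].
    destruct (identity_expansion A z y) as [P HP];
      [simpl in Hy; intuition congruence|].
    exists (Out x y P Q). now apply t_tensor.
  - destruct Hd as [P HP]. eauto using typed.
  - eauto using typed.
  - eauto using typed.
  - destruct IHstep as [P HP]; simpl; eauto using forwarder_ctx_eq.
    exists P. eapply t_ctx_eq; eauto using ctx_eq_sym.
  - apply IHstep; auto. destruct Hd as [P HP].
    exists P. eapply t_ctx_eq; eauto using ctx_eq_sym.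
Qed.

Lemma terminating_path G :
  terminating (Running G) -> exists n act st, path G n act st /\ st n = Done.
Proof.
  enough (H : forall s, terminating s ->
    exists n act st, st 0 = s /\ (forall i, i <= n -> state_ok (st i)) /\
      (forall i, i < n -> step (st i) (act (S i)) (st (S i))) /\ st n = Done).
  { intros HG. destruct (H _ HG) as (n & act & st & H0 & Hok & Hst & Hn).
    exists n, act, st. repeat split; auto. }
  induction 1 as [|G' a s HG Hs _ (n & act & st & H0 & Hok & Hst & Hn)].
  - exists 0, (fun _ => ActLink 0 0), (fun _ => Done).
    repeat split; auto. intros i Hi; lia.
  (* Actions count from 1 and states from 0: the new action sits at index 1, old actions move up by
     one, and the value at index 0 is arbitrary. *)
  - exists (S n), (fun i => match i with S (S j) => act (S j) | _ => a end),
      (fun i => match i with S j => st j | 0 => Running G' end).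
    repeat split; auto.
    + intros [|i] Hi; simpl; auto. apply Hok; lia.
    + intros [|i] Hi; simpl; [now rewrite H0|]. apply Hst; lia.
Qed.

Lemma path_derivable G n act st :
  path G n act st -> st n = Done -> derivable (Running G).
Proof.
  intros (H0 & Hok & Hst) Hn. rewrite <- H0.
  (* Derivability is propagated backwards; [k] is the distance from the end of the path. *)
  enough (H : forall k, k <= n -> derivable (st (n - k)))
    by (replace 0 with (n - n) by lia; auto).
  induction k as [|k IH]; intros Hk.
  - replace (n - 0) with n by lia. now rewrite Hn.
  - apply (step_derivable _ (act (S (n - S k))) (st (S (n - S k)))).
    + apply Hst; lia.
    + apply Hok; lia.
    + replace (S (n - S k)) with (n - k) by lia. apply IH; lia.
Qed.

(** * Liveness *)

(** [Done] carries no obligation, so one that is pending must be discharged before or on arrival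
    there. *)
Definition holds (p : entry -> Prop) (s : state) : Prop :=
  match s with Running G => Exists p G | Done => False end.

(** [p] describes an obligation of an entry, which only the actions in [good]
    may discharge. *)
Record obligation (p : entry -> Prop) (good : action -> Prop) : Prop := {
  ob_eq e e' : entry_eq e e' -> p e -> p e';
  ob_par x q u y A B :
    p (Entry x q (Some (APar u A B))) -> p (Entry x (q ++ [Msg u y A]) (Some B));
  ob_bot x q u :
    p (Entry x q (Some (ABot u))) -> p (Entry x (q ++ [Star u]) None);
  ob_receive u x z A q C :
    p (Entry u (Msg x z A :: q) C) -> good (ActPar x u) \/ p (Entry u q C);
  ob_send x q u A B :
    p (Entry x q (Some (ATensor u A B))) ->
    good (ActPar x u) \/ p (Entry x q (Some B));
  ob_one x us : Exists p (one_ctx x us) -> good (ActBot x us);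
  ob_covar x a : ~ p (Entry x [] (Some (ACoVar a)));
  ob_var x a : ~ p (Entry x [] (Some (AVar a)))
}.

Section Obligation.
Variables (p : entry -> Prop) (good : action -> Prop).
Hypothesis Hp : obligation p good.

Lemma Exists_ctx_eq G D : ctx_eq G D -> Exists p G -> Exists p D.
Proof.
  intros (G' & HP & HF) HG. rewrite HP in HG. clear HP G.
  induction HF; inversion HG; subst; auto.
  apply Exists_cons_hd. eapply ob_eq; eauto.
Qed.

(** The fields of [obligation] treat the entries that a step rewrites or consumes; all other entries
    are carried over unchanged. *)
Lemma obligation_step s a s' : step s a s' -> holds p s -> good a \/ holds p s'.
Proof.
  induction 1; simpl; intros Hs; try subst D; rewrite ?Exists_cons in *.
  - destruct Hs as [Hs|Hs]; auto.
    apply (ob_par _ _ Hp _ _ _ y) in Hs; auto.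
  - destruct Hs as [Hs|[Hs|Hs]]; auto.
    + apply (ob_receive _ _ Hp) in Hs; tauto.
    + apply (ob_send _ _ Hp) in Hs; tauto.
  - destruct Hs as [Hs|Hs]; auto.
    apply (ob_bot _ _ Hp) in Hs; auto.
  - left. now apply (ob_one _ _ Hp).
  - rewrite Exists_nil in Hs.
    destruct Hs as [Hs|[Hs|[]]];
      [now apply (ob_covar _ _ Hp) in Hs | now apply (ob_var _ _ Hp) in Hs].
  - apply IHstep; simpl; eauto using Exists_ctx_eq.
  - destruct (IHstep Hs); eauto using Exists_ctx_eq.
Qed.

(** An obligation that survived all [n - i] remaining steps would hold in [Done], which is
    impossible. *)
Lemma obligation_met G n act st i :
  path G n act st -> st n = Done -> i <= n -> holds p (st i) ->
  exists k, i < k <= n /\ good (act k).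
Proof.
  intros (_ & _ & Hst) Hn Hi. remember (n - i) as d eqn:Hd.
  revert i Hi Hd. induction d as [|d IH]; intros i Hi Hd Hs.
  - replace i with n in Hs by lia. rewrite Hn in Hs. easy.
  - destruct (obligation_step _ _ _ (Hst i ltac:(lia)) Hs) as [Hg|Hs'].
    + exists (S i). split; [lia | auto].
    + destruct (IH (S i)) as (k & Hk & Hg); auto; try lia.
      exists k. split; [lia | auto].
Qed.

Lemma has_form_holds s e G : has_form s (e :: G) -> p e -> holds p s.
Proof.
  intros (G' & -> & E) He. apply ctx_eq_sym in E.
  eapply Exists_ctx_eq; eauto.
Qed.

End Obligation.

(** * The four kinds of liveness obligation *)

Lemma In_queue_eq b q q' : queue_eq q q' -> In b q -> In b q'.
Proof. intros H. apply Permutation_in, queue_eq_perm, H. Qed.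

Lemma Exists_one_ctx p x us :
  Exists p (one_ctx x us) <->
  (exists u, In u us /\ p (Entry u [Star x] None)) \/
  p (Entry x [] (Some (AOne us))).
Proof.
  unfold one_ctx. rewrite Exists_app, Exists_cons, Exists_nil, !Exists_exists.
  setoid_rewrite in_map_iff. firstorder (subst; eauto).
Qed.

(** The message may sit anywhere in the queue, which makes the predicate stable under box swaps and
    under appending. Only a reception takes a message out, and a front box sent by [x] leaves by
    [ActPar x u]. *)
Lemma obligation_msg x u :
  obligation (fun e => endpoint e = u /\ exists z A, In (Msg x z A) (entry_queue e))
             (fun a => a = ActPar x u).
Proof.
  split; simpl.
  - intros e e' (E1 & E2 & E3) (<- & z & A & H).
    eauto 6 using In_queue_eq.
  - intros ? ? ? ? ? ? (<- & z & A & H). eauto 7 using in_or_app.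
  - intros ? ? ? (<- & z & A & H). eauto 7 using in_or_app.
  - intros ? ? ? ? ? ? (<- & z & A & [H|H]); [left; congruence | eauto 7].
  - eauto.
  - intros y us H. apply Exists_one_ctx in H.
    destruct H as [(v & _ & _ & z & A & [H|[]])|(_ & z & A & [])]. easy.
  - now intros ? ? (_ & z & A & H).
  - now intros ? ? (_ & z & A & H).
Qed.

(** Receptions at a terminated endpoint remove messages but no star. At closing, every star in
    [one_ctx y us] is labelled [y] and sits at a member of [us]. *)
Lemma obligation_star x u :
  obligation
    (fun e => endpoint e = u /\ entry_type e = None /\ In (Star x) (entry_queue e))
    (fun a => exists us, a = ActBot x us /\ In u us).
Proof.
  split; simpl.
  - intros e e' (E1 & E2 & E3) (<- & H & H').
    rewrite <- E1, <- E2. eauto using In_queue_eq.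
  - easy.
  - easy.
  - intros ? ? ? ? ? ? (<- & H & [H'|H']); [easy | auto].
  - easy.
  - intros y us H. apply Exists_one_ctx in H.
    destruct H as [(v & Hv & <- & _ & [H|[]])|(_ & H & _)]; [|easy].
    exists us. split; [congruence | auto].
  - easy.
  - easy.
Qed.

(** Receiving changes only the queue, so the head tensor goes away only when its own output
    fires. *)
Lemma obligation_tensor x u :
  obligation
    (fun e => endpoint e = x /\ exists A B, entry_type e = Some (ATensor u A B))
    (fun a => a = ActPar x u).
Proof.
  split; simpl.
  - intros e e' (E1 & E2 & E3) (<- & A & B & H).
    rewrite <- E1, <- E2. eauto.
  - now intros ? ? ? ? ? ? (_ & A' & B' & H).
  - now intros ? ? ? (_ & A' & B' & H).
  - eauto.
  - intros ? ? ? ? ? (<- & A' & B' & H). left; congruence.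
  - intros y us H. apply Exists_one_ctx in H.
    now destruct H as [(v & _ & _ & A & B & H)|(_ & A & B & H)].
  - now intros ? ? (_ & A & B & H).
  - now intros ? ? (_ & A & B & H).
Qed.

Lemma obligation_unit x us :
  obligation (fun e => endpoint e = x /\ entry_type e = Some (AOne us))
             (fun a => a = ActBot x us).
Proof.
  split; simpl; try easy.
  - intros e e' (E1 & E2 & E3) (<- & H). now rewrite <- E1, <- E2.
  - eauto.
  - intros y vs H. apply Exists_one_ctx in H.
    destruct H as [(v & _ & _ & H)|(<- & H)]; simpl in *; congruence.
Qed.

(** * Closing is the last action of a path *)

Lemma step_bot_done s x us s' : step s (ActBot x us) s' -> s' = Done.
Proof.
  remember (ActBot x us) as a eqn:E. induction 1; try easy; auto.
  (* For [s_eq_r] the induction hypothesis equates a running state with [Done]. *)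
  now specialize (IHstep E).
Qed.

Lemma step_done a s : ~ step Done a s.
Proof. remember Done as d eqn:E. induction 1; try easy; auto. Qed.

(** The liveness clauses for stars and units speak of [act n], while [obligation_met] yields some
    [k]. They agree because closing leads to [Done], where no step starts. *)
Lemma path_bot_last G n act st k x us :
  path G n act st -> 0 < k <= n -> act k = ActBot x us -> k = n.
Proof.
  intros (_ & _ & Hst) Hk E. destruct k as [|k]; [lia|].
  pose proof (Hst k ltac:(lia)) as H. rewrite E in H. apply step_bot_done in H.
  destruct (PeanoNat.Nat.eq_dec (S k) n) as [|Hne]; auto.
  pose proof (Hst (S k) ltac:(lia)) as H'. rewrite H in H'.
  now apply step_done in H'.
Qed.

Lemma path_live G n act st : path G n act st -> st n = Done -> live n act st.
Proof.
  intros Hp Hn. split; auto. intros i Hi. repeat split.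
  - intros G' x z A q u C H. pose proof (obligation_msg x u) as Ho.
    apply (obligation_met _ _ Ho G n act st); auto; [lia|].
    apply (has_form_holds _ _ Ho _ _ _ H). simpl; eauto.
  - intros G' x u H. pose proof (obligation_star x u) as Ho.
    destruct (obligation_met _ _ Ho G n act st i)
      as (k & Hk & us & E & Hu); auto; [lia| |].
    { apply (has_form_holds _ _ Ho _ _ _ H). simpl; auto. }
    assert (k = n) as <- by (eapply path_bot_last; eauto; lia). eauto.
  - intros G' q x u A B H. pose proof (obligation_tensor x u) as Ho.
    apply (obligation_met _ _ Ho G n act st); auto; [lia|].
    apply (has_form_holds _ _ Ho _ _ _ H). simpl; eauto.
  - intros G' q x us H. pose proof (obligation_unit x us) as Ho.
    destruct (obligation_met _ _ Ho G n act st i) as (k & Hk & E); auto; [lia| |].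
    { apply (has_form_holds _ _ Ho _ _ _ H). simpl; auto. }
    assert (k = n) as <- by (eapply path_bot_last; eauto; lia). auto.
Qed.

Theorem theorem3 (G : ctx) (HG : forwarder_ctx G) :
  has_live_path G <-> exists F : proc, typed F G.
Proof.
  split.
  - intros (n & act & st & Hp & Hn & _). eapply path_derivable; eauto.
  - intros [F HF].
    destruct (terminating_path G (typed_terminating F G HF))
      as (n & act & st & Hp & Hn).
    exists n, act, st. split; eauto using path_live.
Qed.
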